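(* Let $X$ be a finite set and let $f,g:X\to\mathbb{Z}$ be functions. If there exists an involution $\iota:X\to X$ such that $f=g\circ\iota$, then $f$ and $g$ are equidistributed and $$\sum_{\substack{x\in X,\\ g(x)\neq 0}}\frac{f(x)}{g(x)}=\sum_{\substack{x\in X,\\ f(x)\neq 0}}\frac{g(x)}{f(x)}.$$
   Context: Two functions $f,g:X\to\mathbb{Z}$ on a finite set $X$ are equidistributed if $\sum_{x\in X}q^{f(x)}=\sum_{x\in X}q^{g(x)}$ in $\mathbb{N}[q,q^{-1}]$. An involution is a map $\iota$ with $\iota\circ\iota=\mathrm{id}$. *)

(* Defs.v *)
From HB Require Import structures.
From mathcomp Require Import all_boot all_order all_algebra.
From mathcomp Require Import finmap.

Set Implicit Arguments.
Unset Strict Implicit.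
Unset Printing Implicit Defensive.

Import GRing.Theory.

Local Open Scope fset_scope.
Local Open Scope ring_scope.

(** The semiring N[q, q^-1]: an element is its finitely supported family of
    coefficients, and multiplication is convolution. The monoid algebras of
    mathcomp-multinomials do not apply here: they require coefficients in a
    group and exponents in a monoid without nontrivial units. *)

Record laurentN : predArgType :=
  LaurentN { laurentN_val : {fsfun int -> nat with 0%N} }.

HB.instance Definition _ := [isNew for laurentN_val].
HB.instance Definition _ := [Choice of laurentN by <:].

Definition lcoef (k : int) (p : laurentN) : nat := laurentN_val p k.
Definition lsupp (p : laurentN) : {fset int} := finsupp (laurentN_val p).

Lemma laurentNP (p r : laurentN) :
  (forall k, lcoef k p = lcoef k r) <-> p = r.
Proof.
by case: p r => [p] [r]; split=> [h|->//]; congr LaurentN; apply/fsfunP/h.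
Qed.

Lemma lcoef_out k p : k \notin lsupp p -> lcoef k p = 0%N.
Proof. exact: fsfun_dflt. Qed.

Definition lzero : laurentN := LaurentN [fsfun].
Definition ladd (p r : laurentN) : laurentN :=
  LaurentN [fsfun k in lsupp p `|` lsupp r => (lcoef k p + lcoef k r)%N].

(** The monomial [n q^k]. *)
Definition lmono (n : nat) (k : int) : laurentN :=
  LaurentN [fsfun j in [fset k] => n].

Lemma lcoef_zero k : lcoef k lzero = 0%N.
Proof. exact: fsfun0E. Qed.

Lemma lcoef_add k p r : lcoef k (ladd p r) = (lcoef k p + lcoef k r)%N.
Proof.
rewrite /lcoef fsfun_fun in_fsetU -!/(lcoef _ _); case: ifP => //.
by move/negbT; rewrite negb_or => /andP[hp hr]; rewrite !lcoef_out.
Qed.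

Lemma lcoef_mono n k j : lcoef j (lmono n k) = (n * (j == k))%N.
Proof.
by rewrite /lcoef fsfun_fun in_fset1; case: (j == k); rewrite (muln1, muln0).
Qed.

Lemma laddA : associative ladd.
Proof. by move=> p r s; apply/laurentNP=> k; rewrite !lcoef_add addnA. Qed.
Lemma laddC : commutative ladd.
Proof. by move=> p r; apply/laurentNP=> k; rewrite !lcoef_add addnC. Qed.
Lemma ladd0 : left_id lzero ladd.
Proof. by move=> p; apply/laurentNP=> k; rewrite lcoef_add lcoef_zero. Qed.

HB.instance Definition _ := GRing.isNmodule.Build laurentN laddA laddC ladd0.

Lemma lcoefD k (p r : laurentN) : lcoef k (p + r) = (lcoef k p + lcoef k r)%N.
Proof. exact: lcoef_add. Qed.

Lemma lcoef_sum k I (s : seq I) (P : pred I) (F : I -> laurentN) :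
  lcoef k (\sum_(i <- s | P i) F i) = (\sum_(i <- s | P i) lcoef k (F i))%N.
Proof. exact: (big_morph _ (lcoefD k) (lcoef_zero k)). Qed.

Lemma lmono0 k : lmono 0 k = 0.
Proof. by apply/laurentNP=> j; rewrite lcoef_mono lcoef_zero. Qed.

Lemma lmonoD m n k : lmono (m + n) k = lmono m k + lmono n k.
Proof. by apply/laurentNP=> j; rewrite lcoefD !lcoef_mono mulnDl. Qed.

Definition lmul (p r : laurentN) : laurentN :=
  \sum_(i <- lsupp p) \sum_(j <- lsupp r)
    lmono (lcoef i p * lcoef j r) (i + j).

Lemma big_lsupp (D : {fset int}) (p : laurentN) (F : nat -> int -> laurentN) :
  lsupp p `<=` D -> (forall i, F 0%N i = 0) ->
  \sum_(i <- lsupp p) F (lcoef i p) i = \sum_(i <- D) F (lcoef i p) i.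
Proof.
move=> sub F0; apply: big_fset_incl => // i _ hi.
by rewrite lcoef_out.
Qed.

Lemma lmulEw (D E : {fset int}) (p r : laurentN) :
  lsupp p `<=` D -> lsupp r `<=` E ->
  lmul p r = \sum_(i <- D) \sum_(j <- E) lmono (lcoef i p * lcoef j r) (i + j).
Proof.
move=> hp hr; rewrite /lmul.
rewrite (@big_lsupp D p
  (fun n i => \sum_(j <- lsupp r) lmono (n * lcoef j r) (i + j))) //.
  apply: eq_bigr => i _.
  apply: (@big_lsupp E r (fun n j => lmono (lcoef i p * n) (i + j))) => // j.
  by rewrite muln0 lmono0.
by move=> i; rewrite big1 // => j _; rewrite mul0n lmono0.
Qed.

Lemma lmulC : commutative lmul.
Proof.
move=> p r; rewrite /lmul exchange_big /=; apply: eq_bigr => i _.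
by apply: eq_bigr => j _; rewrite mulnC addrC.
Qed.

Lemma lmulDl : left_distributive lmul +%R.
Proof.
move=> p r s; set D := lsupp p `|` lsupp r `|` lsupp (p + r).
have hp : lsupp p `<=` D by rewrite /D -fsetUA fsubsetUl.
have hr : lsupp r `<=` D by rewrite /D fsetUAC fsubsetUr.
have hpr : lsupp (p + r) `<=` D by rewrite fsubsetUr.
rewrite (lmulEw hp (fsubset_refl _)) (lmulEw hr (fsubset_refl _)).
rewrite (lmulEw hpr (fsubset_refl _)).
rewrite -big_split; apply: eq_bigr => i _; rewrite -big_split.
by apply: eq_bigr => j _; rewrite lcoefD mulnDl lmonoD.
Qed.

Lemma lmul0 : left_zero 0 lmul.
Proof.
move=> p; rewrite /lmul big1 // => i _; rewrite big1 // => j _.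
by rewrite lcoef_zero mul0n lmono0.
Qed.

Lemma lsupp_mono n k : lsupp (lmono n k) `<=` [fset k].
Proof.
apply/fsubsetP=> j; apply: contraLR; rewrite in_fset1 => /negbTE jk.
by rewrite memNfinsupp -/(lcoef _ _) lcoef_mono jk muln0.
Qed.

Lemma lmul_mono m n j k : lmul (lmono m j) (lmono n k) = lmono (m * n) (j + k).
Proof.
rewrite (lmulEw (lsupp_mono _ _) (lsupp_mono _ _)) !big_seq_fset1.
by rewrite !lcoef_mono !eqxx !muln1.
Qed.

Lemma laurentNE p : p = \sum_(i <- lsupp p) lmono (lcoef i p) i.
Proof.
apply/laurentNP=> k; rewrite lcoef_sum.
have [kp|kp] := boolP (k \in lsupp p).
  rewrite (big_fsetD1 k) //= lcoef_mono eqxx muln1 big1_fset ?addn0 // => i.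
  by rewrite in_fsetD1 lcoef_mono eq_sym => /andP[/negbTE-> _]; rewrite muln0.
rewrite lcoef_out // big1_fset // => i ip _; rewrite lcoef_mono.
by case: eqP ip kp => [-> ->|]; rewrite ?muln0.
Qed.

Lemma laurentN_ind (P : laurentN -> Prop) :
  P 0 -> (forall p r, P p -> P r -> P (p + r)) ->
  (forall n k, P (lmono n k)) -> forall p, P p.
Proof. by move=> P0 PD Pm p; rewrite (laurentNE p); apply: big_ind. Qed.

Lemma lmulDr : right_distributive lmul +%R.
Proof. by move=> p r s; rewrite ![lmul p _]lmulC lmulDl. Qed.

Lemma lmulA : associative lmul.
Proof.
move=> p r s.
elim/laurentN_ind: p => [|p p' hp hp'|a i]; first by rewrite !lmul0.
  by rewrite !lmulDl hp hp'.
elim/laurentN_ind: r => [|r r' hr hr'|b j].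
- by rewrite [lmul _ 0]lmulC !lmul0 lmulC lmul0.
- by rewrite !(lmulDl, lmulDr) hr hr'.
elim/laurentN_ind: s => [|s s' hs hs'|c k].
- by rewrite ![lmul _ 0]lmulC !lmul0 lmulC lmul0.
- by rewrite !lmulDr hs hs'.
by rewrite !lmul_mono mulnA addrA.
Qed.

Lemma lmul1 : left_id (lmono 1 0) lmul.
Proof.
elim/laurentN_ind => [|p p' hp hp'|n k].
- by rewrite lmulC lmul0.
- by rewrite lmulDr hp hp'.
by rewrite lmul_mono mul1n add0r.
Qed.

Lemma lone_neq0 : lmono 1 0 != 0.
Proof.
apply/eqP=> /(congr1 (lcoef 0)).
by rewrite lcoef_mono eqxx lcoef_zero.
Qed.

HB.instance Definition _ := GRing.Nmodule_isComNzSemiRing.Build laurentN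
  lmulA lmulC lmul1 lmulDl lmul0 lone_neq0.

(** [qpow k] is [q^k], for [k] of either sign. *)
Definition qpow (k : int) : laurentN := lmono 1 k.

Lemma qpow0 : qpow 0 = 1.
Proof. by []. Qed.

Lemma qpowD j k : qpow (j + k) = qpow j * qpow k.
Proof. by rewrite /qpow [RHS]lmul_mono. Qed.

Lemma qpow_nat n : qpow n%:Z = qpow 1 ^+ n.
Proof. by elim: n => // n IHn; rewrite intS qpowD IHn exprS. Qed.

Definition equidistributed (X : finType) (f g : X -> int) : Prop :=
  \sum_x qpow (f x) = \sum_x qpow (g x).

(* Main.v *)
Require Import Defs.
From mathcomp Require Import all_boot all_order all_algebra.

Local Open Scope ring_scope.

(** An involution is a bijection that exchanges the roles of the two functions:
    applying it to the argument of [f = g \o iota] also gives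
    [f \o iota = g]. Reindexing by [iota] then turns each sum into the other. *)
Theorem proposition3p10 (X : finType) (f g : X -> int) :
  (exists iota : X -> X, involutive iota /\ f =1 g \o iota) ->
  equidistributed f g /\
  \sum_(x : X | g x != 0) (f x)%:Q / (g x)%:Q
    = \sum_(x : X | f x != 0) (g x)%:Q / (f x)%:Q.
Proof.
move=> [iota [iotaK fE]].
have gE x : f (iota x) = g x by rewrite fE /= iotaK.
split; rewrite /equidistributed [RHS](reindex_inj (inv_inj iotaK)) /=.
  by apply: eq_bigr => x _; rewrite fE.
by apply: eq_big => [x|x _]; rewrite gE // fE.
Qed.
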